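(* Let $A=\Bbbk Q/J^n$ for some $n\ge2$, where $Q$ is a finite quiver and $J$ is the two-sided ideal of $\Bbbk Q$ generated by the arrows, and let $f_1,\dots,f_m\in B^1(A)[1]=\operatorname{Hom}_{E-E}(\Bbbk AP_2,A)$ be elements of degree $1$ of the shifted Bardzell complex. Then $$l_m(f_1\otimes\cdots\otimes f_m)=0\qquad\text{for all } m\ge3,$$ where $(l_m)$ is the $L_\infty$-structure on $B^*(A)[1]$ defined in the context.
   Context: Algebra. $\Bbbk$ is a field of characteristic zero, $Q$ a finite quiver, $I$ an admissible ideal of $\Bbbk Q$ generated by paths (here $I=J^n$), $\mathcal R$ the set of paths in $I$ minimal with respect to inclusion (for $I=J^n$: the paths of length $n$), $A=\Bbbk Q/I$, $E=\Bbbk Q_0$. Paths $\alpha_1\cdots\alpha_l$ satisfy $t(\alpha_i)=s(\alpha_{i+1})$. $A=E\oplus\operatorname{rad}A$; write $a=a_E+a_r$. Reduced bar resolution. $\overline C_k(A)=A\otimes_E(\operatorname{rad}A)^{\otimes_Ek}\otimes_EA$, $d_k(a_0\otimes\cdots\otimes a_{k+1})=\sum_{i=0}^k(-1)^ia_0\otimes\cdots\otimes a_ia_{i+1}\otimes\cdots\otimes a_{k+1}$, $s_k(a\otimes x)=1\otimes a_r\otimes x$. Bardzell's resolution. $AP_0=Q_0$, $AP_1=Q_1$; for $k\ge2$, $AP_k$ is the set of supports of $k$-concatenations: for a path $T$, with the positions along $T$ ordered and $\mathcal R(T)$ the set of (occurrences of) paths of $\mathcal R$ in $T$, take $p_1\in\mathcal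 R(T)$, $p_2$ of minimal source in $\{p\in\mathcal R(T):s(p_1)<s(p)<t(p_1)\}$ and, for $j\ge2$, $p_{j+1}$ of minimal source in $\{p\in\mathcal R(T):t(p_{j-1})\le s(p)<t(p_j)\}$ (when nonempty); $(p_1,\dots,p_{k-1})$ is a $k$-concatenation with support the subpath of $T$ from $s(p_1)$ to $t(p_{k-1})$. So $AP_2=\mathcal R$. For $w\in AP_k$, $\operatorname{Sub}(w)$ is the set of (occurrences of) $\psi\in AP_{k-1}$ dividing $w$, $w=L(\psi)\psi R(\psi)$; for $k$ odd it has two elements with $w=\psi_1R(\psi_1)=L(\psi_2)\psi_2$. $B_k(A)=A\otimes_E\Bbbk AP_k\otimes_EA$, $\delta_k(1\otimes w\otimes1)=\sum_{\psi\in\operatorname{Sub}(w)}L(\psi)\otimes\psi\otimes R(\psi)$ for $k$ even, $L(\psi_2)\otimes\psi_2\otimes1-1\otimes\psi_1\otimes R(\psi_1)$ for $k$ odd. Comparison morphisms ($A$-bimodule maps). $F_k:B_k(A)\to\overline C_k(A)$: $F_0=\mathrm{Id}$, $F_k(1\otimes w\otimes1)=s_{k-1}F_{k-1}\delta_k(1\otimes w\otimes1)$. $G_k:\overline C_k(A)\to B_k(A)$: $G_0=\mathrm{Id}$; for composable paths $v_1,\dots,v_k$ of positive length not in $I$, $G_k(1\otimes v_1\otimes\cdots\otimes v_k\otimes1)=0$ unless $v_{k-1}v_k,v_{k-3}v_{k-2},\dots$ all lie in $I$; if they do, for $k$ even it is $L\otimes w\otimes R$ with $v_1\cdots v_k=LwR$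 and $w\in AP_k$ the divisor with minimal source ($0$ if none), and for $k$ odd it is $\sum L\otimes w\otimes R$ over all factorizations $v_1\cdots v_k=LwR$, $w\in AP_k$, $s(w)<t(v_1)$ (as positions). $H_k:\overline C_k(A)\to\overline C_{k+1}(A)$ bimodule maps: $H_0=0$, $H_k(1\otimes x)=(s_kF_kG_k-s_kH_{k-1}d_k)(1\otimes x)$. Cochains. $f\in\operatorname{Hom}_{E-E}(V,A)$ corresponds to $\hat f\in\operatorname{Hom}_{A-A}(A\otimes_EV\otimes_EA,A)$, $f(v)=\hat f(1\otimes v\otimes1)$. $\overline C^k(A)=\operatorname{Hom}_{E-E}((\operatorname{rad}A)^{\otimes_Ek},A)$, $d^kf=(-1)^k\hat fd_{k+1}$; $B^k(A)=\operatorname{Hom}_{E-E}(\Bbbk AP_k,A)$ with differential $f\mapsto(-1)^k\hat f\delta_{k+1}$; $F^k(f)=\hat fF_k$, $G^k(f)=\hat fG_k$, $H^k(f)=(-1)^{k-1}\hat fH_{k-1}$. Gerstenhaber bracket of $f\in\overline C^p(A)$, $g\in\overline C^q(A)$: $f\circ g=\sum_{i=0}^{p-1}(-1)^{i(q+1)}f(\mathrm{Id}^{\otimes i}\otimes g\otimes\mathrm{Id}^{\otimes p-i-1})$, $[f,g]=f\circ g-(-1)^{(p-1)(q-1)}g\circ f$ (cochains are extended by zero when an argument lies in $E$). Shift: $X[1]^k=X^{k+1}$; $B^1(A)[1]$ denotes the degree $1$ part of $B^*(A)[1]$. Recursive definition. For homogeneous $x_1,\dots,x_k$ and $\sigma\in\mathbb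 S_k$: $x_1\wedge\dots\wedge x_k=\varepsilon(\sigma)x_{\sigma(1)}\wedge\dots\wedge x_{\sigma(k)}$ in the free graded commutative algebra, $\chi(\sigma)=\operatorname{sgn}(\sigma)\varepsilon(\sigma)$, $\kappa(\sigma)_t=(-1)^{(t-1)+(k-t-1)\sum_{p=1}^t|x_{\sigma(p)}|}$, $\hat\sigma(x_1\otimes\dots\otimes x_k)=x_{\sigma(1)}\otimes\dots\otimes x_{\sigma(k)}$; $\mathbb S_{t,k-t}$ is the set of $\sigma\in\mathbb S_k$ with $\sigma(1)<\dots<\sigma(t)$, $\sigma(t+1)<\dots<\sigma(k)$, $\mathbb S^-_{t,k-t}$ the subset with $\sigma(1)<\sigma(t+1)$. $l_1$ is the differential of $B^*(A)[1]$, $u_1=v_1=0$, $\phi_1=G^*$, and for $k>1$: $v_k=\sum_{t=1}^{k-1}\sum_{\tau\in\mathbb S^-_{t,k-t}}\chi(\tau)\kappa(\tau)_t[\phi_t,\phi_{k-t}]\hat\tau$, $l_k=F^*v_k$, $u_k=\sum_{r=2}^k\sum_{\tau\in\mathbb S_{r,k-r}}(-1)^{r(k-r)+1}\chi(\tau)\phi_{k-r+1}(l_r\otimes\mathrm{Id}^{\otimes k-r})\hat\tau$, $\phi_k=H^*(u_k+v_k)$, as maps on $\otimes^k(B^*(A)[1])$, where $[\phi_s,\phi_t]$ applies $\phi_s$ to the first $s$ factors, $\phi_t$ to the last $t$ and takes the bracket. *)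

(* Defs.v *)
From Stdlib Require Import FunctionalExtensionality.
From HB Require Import structures.
From mathcomp Require Import all_boot all_order all_algebra all_fingroup.
From mathcomp Require Import finmap monalg.

Set Implicit Arguments.
Unset Strict Implicit.
Unset Printing Implicit Defensive.

Import GRing.Theory.
Local Open Scope ring_scope.

Record quiver := Quiver {
  vert : finType;
  arr : finType;
  src : arr -> vert;
  tgt : arr -> vert
}.

Section Paths.
Variable Q : quiver.

Fixpoint walk (e : vert Q) (s : seq (arr Q)) : bool :=
  if s is a :: s' then (src a == e) && walk (tgt a) s' else true.

Definition wend (e : vert Q) (s : seq (arr Q)) : vert Q :=
  last e (map (@tgt Q) s).

(* (e, s) is the path a_1 ... a_l, s = [:: a_1; ...; a_l], starting at e;
   the paths of length 0 are the vertices. *)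
Record qpath := QPath {
  pval : vert Q * seq (arr Q);
  _ : walk pval.1 pval.2
}.
HB.instance Definition _ := [isSub for pval].
HB.instance Definition _ := [Choice of qpath by <:].

Definition psrc (p : qpath) : vert Q := (pval p).1.
Definition parr (p : qpath) : seq (arr Q) := (pval p).2.
Definition plen (p : qpath) : nat := size (parr p).
Definition ptgt (p : qpath) : vert Q := wend (psrc p) (parr p).

Definition triv (e : vert Q) : qpath := QPath (pval := (e, [::])) isT.

Lemma walk_cat e s1 s2 : walk e (s1 ++ s2) = walk e s1 && walk (wend e s1) s2.
Proof. by elim: s1 e => //= a s1 IH e; rewrite IH andbA. Qed.

Lemma walk_take i (p : qpath) : walk (psrc p) (take i (parr p)).
Proof.
by have := valP p; rewrite /= -{1}(cat_take_drop i (pval p).2) walk_cat => /andP[].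
Qed.

Lemma walk_drop i (p : qpath) :
  walk (wend (psrc p) (take i (parr p))) (drop i (parr p)).
Proof.
by have := valP p; rewrite /= -{1}(cat_take_drop i (pval p).2) walk_cat => /andP[].
Qed.

Definition ptake i (p : qpath) : qpath :=
  QPath (pval := (psrc p, take i (parr p))) (walk_take i p).
Definition pdrop i (p : qpath) : qpath :=
  QPath (pval := (wend (psrc p) (take i (parr p)), drop i (parr p)))
        (walk_drop i p).

(* The subpath of p between the positions i <= j, 0 <= i, j <= plen p. *)
Definition psub (p : qpath) i j : qpath := pdrop i (ptake j p).

Definition composable : seq qpath -> bool :=
  sorted (fun p q => ptgt p == psrc q).

(* Concatenation; the value is irrelevant unless composable [:: p; q]. *)
Definition pcat (p q : qpath) : qpath :=
  insubd p (psrc p, parr p ++ parr q).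

(* The pairs of positions (i, j) at which T has a subpath satisfying P,
   listed by increasing source i. *)
Definition occs (P : pred qpath) (T : qpath) : seq (nat * nat) :=
  [seq ij <- [seq (i, j) | i <- iota 0 (plen T).+1, j <- iota 0 (plen T).+1] |
     (ij.1 <= ij.2)%N && P (psub T ij.1 ij.2)].

End Paths.

Section Free.
Variable k : fieldType.

Definition lin (T : choiceType) (M : lmodType k) (f : T -> M)
  (x : {malg k[T]}) : M := \sum_(i <- msupp x) x@_i *: f i.

(* [elt x]: the basis element x if P x, and 0 otherwise. *)
Definition elt (T : choiceType) (P : pred T) (x : T) : {malg k[{x : T | P x}]} :=
  if insub x is Some u then << u >> else 0.

(* A function on the basis {x | P x}, extended by zero. *)
Definition ext0 (T : choiceType) (P : pred T) (M : zmodType)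
  (f : {x : T | P x} -> M) (x : T) : M :=
  if insub x is Some u then f u else 0.

End Free.

(* A = kQ/I, for I the ideal generated by the paths in R                *)

Section Monomial.
Variables (k : fieldType) (Q : quiver) (R : pred (qpath Q)).

Local Notation path := (qpath Q).

Definition inI (p : path) : bool := occs R p != [::].

(* A has as basis the paths which are not in I. *)
Definition red : pred path := fun p => ~~ inI p.
Local Notation alg := {malg k[{p : path | red p}]}.

(* The class of a path in A, and the product p a q in A of the classes of two
   paths p, q and of a in A. *)
Definition cls (p : path) : alg := elt k red p.
Definition sand (p : path) (a : alg) (q : path) : alg :=
  lin (fun x => if composable [:: p; val x; q]
                then cls (pcat (pcat p (val x)) q) else 0) a.

(* Reduced bar resolution: (a, v, b) stands for a (x) v_1 (x) ... (x) v_k (x) b.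
   The tensor products over E have as basis the tuples of composable paths, taken of positive
   length in the factors rad A. All degrees k = size v are put together. *)
Definition bar_basis : pred (path * seq path * path) := fun x =>
  [&& composable (x.1.1 :: rcons x.1.2 x.2), red x.1.1, red x.2 &
      all (fun p => red p && (0 < plen p)%N) x.1.2].
Local Notation bar := {malg k[{x : path * seq path * path | bar_basis x}]}.
Definition barelt : path * seq path * path -> bar := elt k bar_basis.

(* The product p x q for x in the bar resolution. *)
Definition baract (p : path) (x : bar) (q : path) : bar :=
  lin (fun y => let: (a, v, b) := val y in
         if composable [:: p; a] && composable [:: b; q]
         then barelt (pcat p a, v, pcat b q) else 0) x.

(* v_1 (x) ... (x) v_{i+1} v_{i+2} (x) ... (x) v_k *)
Fixpoint merge_at i (v : seq path) : seq path :=
  match v, i with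
  | p :: q :: v', 0 => pcat p q :: v'
  | p :: v', i'.+1 => p :: merge_at i' v'
  | _, _ => v
  end.

(* The terms i = 0, 0 < i < k and i = k of d_k, for k = size v > 0; the map
   A (x)_E A -> A, in degree 0, is not used. *)
Definition bard_basis (x : path * seq path * path) : bar :=
  let: (a, v, b) := x in
  if v is v1 :: v' then
    barelt (pcat a v1, v', b)
    + \sum_(1 <= i < size v) (-1) ^+ i *: barelt (a, merge_at i.-1 v, b)
    + (-1) ^+ size v *: barelt (a, belast v1 v', pcat (last v1 v') b)
  else 0.
Definition bard (x : bar) : bar := lin (fun y => bard_basis (val y)) x.

Definition bars (x : bar) : bar :=
  lin (fun y => let: (a, v, b) := val y in
         barelt (triv (psrc a), a :: v, b)) x.

(* Bardzell's p_{j+1}: the element of R(T) of minimal source in [lo, hi[, if any *)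
Definition next_rel (T : path) (lo hi : nat) : option (nat * nat) :=
  ohead [seq p <- occs R T | (lo <= p.1 < hi)%N].

(* The last element of the concatenation obtained from p by adding m elements,
   lo being the lower bound on the source of the first one added. *)
Fixpoint concat_end (T : path) (lo : nat) (p : nat * nat) (m : nat)
  : option (nat * nat) :=
  if m is m'.+1 then
    if next_rel T lo p.2 is Some q then concat_end T p.2 q m' else None
  else Some p.

(* w is in AP_j. For j >= 2, w is the support of a j-concatenation
   (p_1, ..., p_{j-1}): the elements of R occurring in a concatenation lie in
   its support, so that it can be formed in T = w. *)
Definition AP (j : nat) (w : path) : bool :=
  match j with
  | 0 => plen w == 0
  | 1 => plen w == 1
  | m.+2 => has (fun p1 => (p1.1 == 0) &&
                  (omap snd (concat_end w p1.1.+1 p1 m) == Some (plen w)))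
                (occs R w)
  end%N.

Definition apb : pred (nat * path) := fun jw => AP jw.1 jw.2.

(* (a, (j, w), b) stands for a (x) w (x) b in B_j(A), w in AP_j. *)
Definition bz_basis : pred (path * (nat * path) * path) := fun x =>
  [&& composable [:: x.1.1; x.1.2.2; x.2], red x.1.1, red x.2 & apb x.1.2].
Local Notation bz := {malg k[{x : path * (nat * path) * path | bz_basis x}]}.
Definition bzelt : path * (nat * path) * path -> bz := elt k bz_basis.

Definition bzact (p : path) (x : bz) (q : path) : bz :=
  lin (fun y => let: (a, w, b) := val y in
         if composable [:: p; a] && composable [:: b; q]
         then bzelt (pcat p a, w, pcat b q) else 0) x.

(* delta_j (1 (x) w (x) 1); for j odd the occurrences of source 0, resp. of
   target plen w, are psi_1, resp. psi_2. *)
Definition bzd_gen (j : nat) (w : path) : bz :=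
  if j is j'.+1 then
    let sub := occs (AP j') w in
    let term ij := bzelt (ptake ij.1 w, (j', psub w ij.1 ij.2), pdrop ij.2 w) in
    if odd j then
      \sum_(ij <- sub | ij.2 == plen w) term ij
      - \sum_(ij <- sub | ij.1 == 0%N) term ij
    else \sum_(ij <- sub) term ij
  else 0.

(* X_gen is the value of X on 1 (x) - (x) 1       *)

Fixpoint F_gen (j : nat) (w : path) : bar :=
  if j is j'.+1 then
    bars (lin (fun y => let: (a, jw, b) := val y in
                 baract a (F_gen j' jw.2) b) (bzd_gen j w))
  else barelt (w, [::], w).

Definition F (x : bz) : bar :=
  lin (fun y => let: (a, jw, b) := val y in baract a (F_gen jw.1 jw.2) b) x.

(* v_{k-1} v_k, v_{k-3} v_{k-2}, ... are in I, for k = size v *)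
Fixpoint G_cond (v : seq path) : bool :=
  if v is p :: v' then
    (if v' is q :: _ then odd (size v) || inI (pcat p q) else true) && G_cond v'
  else true.

(* (e, v) stands for 1 (x) v_1 (x) ... (x) v_k (x) 1 with v starting at e; for
   k = 0 this is the element e (x) e. *)
Definition G_gen (ev : vert Q * seq path) : bz :=
  let: (e, v) := ev in
  let T := foldl (@pcat Q) (triv e) v in
  let occ := occs (AP (size v)) T in
  let term ij :=
    bzelt (ptake ij.1 T, (size v, psub T ij.1 ij.2), pdrop ij.2 T) in
  if ~~ G_cond v then 0
  else if odd (size v) then
    \sum_(ij <- occ | (ij.1 < plen (head T v))%N) term ij
  else if occ is ij :: _ then term ij else 0.

Definition G (x : bar) : bz :=
  lin (fun y => let: (a, v, b) := val y in bzact a (G_gen (ptgt a, v)) b) x.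

Fixpoint H_gen (j : nat) (ev : vert Q * seq path) : bar :=
  if j is j'.+1 then
    let: (e, v) := ev in
    let x := barelt (triv e, v, triv (last e (map (@ptgt Q) v))) in
    bars (F (G x))
    - bars (lin (fun y => let: (a, v, b) := val y in
                   baract a (H_gen j' (ptgt a, v)) b) (bard x))
  else 0.

(* Cochains. An element of Hom_{E-E}(V, A) is given by its values on a basis
   of V. All degrees are put together: a cochain is a family (f_p)_p, f_p of
   degree p, and is homogeneous of degree p when f_q = 0 for q <> p. *)

Definition chain : pred (vert Q * seq path) := fun ev =>
  composable (triv ev.1 :: ev.2) && all (fun p => red p && (0 < plen p)%N) ev.2.
Definition barcochain : Type := {ev : vert Q * seq path | chain ev} -> alg.

Definition bzcochain : Type := {jw : nat * path | apb jw} -> alg.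

(* f is in B^p(A) = Hom_{E-E}(k AP_p, A) *)
Definition in_bz (p : nat) (f : bzcochain) : Prop :=
  (forall w x, x \in msupp (f w) ->
     psrc (val x) = psrc (val w).2 /\ ptgt (val x) = ptgt (val w).2)
  /\ (forall w, (val w).1 != p -> f w = 0).

(* \hat f *)
Definition barhat (f : barcochain) (x : bar) : alg :=
  lin (fun y => let: (a, v, b) := val y in
         sand a (ext0 f (ptgt a, v)) b) x.
Definition bzhat (f : bzcochain) (x : bz) : alg :=
  lin (fun y => let: (a, jw, b) := val y in sand a (ext0 f jw) b) x.

(* Differential of B^*(A), F^*, G^* and H^*, written on each basis element *)
Definition bzdiff (f : bzcochain) : bzcochain := fun w =>
  let: (j, p) := val w in (-1) ^+ j.-1 *: bzhat f (bzd_gen j p).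
Definition Fup (f : barcochain) : bzcochain := fun w =>
  let: (j, p) := val w in barhat f (F_gen j p).
Definition Gup (f : bzcochain) : barcochain := fun c => bzhat f (G_gen (val c)).
Definition Hup (f : barcochain) : barcochain := fun c =>
  let j := size (val c).2 in (-1) ^+ j *: barhat f (H_gen j (val c)).

(* f o g evaluated at (e, v), for f of degree p, g of degree q and
   size v = p + q - 1 *)
Definition circ (p q : nat) (f g : barcochain) (ev : vert Q * seq path) : alg :=
  let: (e, v) := ev in
  \sum_(i < p) (-1) ^+ (i * q.+1) *:
     lin (fun a => ext0 f (e, take i v ++ val a :: drop (i + q) v))
         (ext0 g (last e (map (@ptgt Q) (take i v)), take q (drop i v))).

(* The Gerstenhaber bracket, i.e. the sum of the [f_p, g_q], p + q = size v + 1;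
   (p - 1)(q - 1) and (p + 1)(q + 1) have the same parity. *)
Definition bracket (f g : barcochain) : barcochain := fun c =>
  \sum_(p < (size (val c).2).+2)
     let q := ((size (val c).2).+1 - p)%N in
     circ p q f g (val c) - (-1) ^+ (p.+1 * q.+1) *: circ q p g f (val c).

(* A homogeneous element of B^*(A)[1], with its (shifted) degree *)
Definition helt : Type := (int * bzcochain)%type.

Definition hatp (x : seq helt) (s : 'S_(size x)) : seq helt :=
  [seq nth (0, fun=> 0) x (s i) | i : 'I_(size x)].

Definition hdeg (x : seq helt) (i : nat) : int := (nth (0, fun=> 0) x i).1.

(* The Koszul sign: each inversion i < j, s i > s j exchanges x_(s i), x_(s j) *)
Definition epsilon (x : seq helt) (s : 'S_(size x)) : k :=
  \prod_(i < size x) \prod_(j < size x | (i < j)%N && (s j < s i)%N)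
     (-1) ^ (hdeg x (s i) * hdeg x (s j)).
Definition chi (x : seq helt) (s : 'S_(size x)) : k := (-1) ^+ s * epsilon s.

(* kappa(s)_t, as a function of y = (x_(s 1), ..., x_(s k)) *)
Definition kappa (t : nat) (y : seq helt) : k :=
  (-1) ^ ((t%:Z - 1) + ((size y)%:Z - t%:Z - 1) * \sum_(z <- take t y) z.1).

Definition shuffle (m t : nat) (s : 'S_m) : bool :=
  [forall i : 'I_m, forall j : 'I_m,
     (i < j)%N && ((j < t)%N || (t <= i)%N) ==> (s i < s j)%N].
Definition shuffle_minus (m t : nat) (s : 'S_m) : bool :=
  shuffle t s &&
  [forall i : 'I_m, forall j : 'I_m,
     (i == 0 :> nat) && (j == t :> nat) ==> (s i < s j)%N].

(* In what follows phi x stands for phi_k (x_1 (x) ... (x) x_k), k = size x, and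
   likewise for l, u and v. v_k and l_k depend on phi_t for t < k only, and so
   does u_k. *)

Definition v_of (phi : seq helt -> barcochain) (x : seq helt) : barcochain :=
  fun c =>
  \sum_(1 <= t < size x) \sum_(s : 'S_(size x) | shuffle_minus t s)
     let y := hatp s in
     (chi s * kappa t y) *: bracket (phi (take t y)) (phi (drop t y)) c.

Definition l_of (phi : seq helt -> barcochain) (x : seq helt) : bzcochain :=
  if x is [:: y] then bzdiff y.2 else Fup (v_of phi x).

(* l_r has degree 2 - r. *)
Definition u_of (phi : seq helt -> barcochain) (x : seq helt) : barcochain :=
  fun c =>
  \sum_(2 <= r < (size x).+1) \sum_(s : 'S_(size x) | shuffle r s)
     let y := hatp s in
     ((-1) ^+ (r * (size x - r) + 1) * chi s) *:
       phi ((\sum_(z <- take r y) z.1 + 2 - r%:Z, l_of phi (take r y))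
              :: drop r y) c.

Fixpoint phi_upto (N : nat) (x : seq helt) : barcochain :=
  if N is N'.+1 then
    if x is [:: y] then Gup y.2
    else Hup (fun c => u_of (phi_upto N') x c + v_of (phi_upto N') x c)
  else fun=> 0.

Definition phi (x : seq helt) : barcochain := phi_upto (size x) x.

Definition l (m : nat) (x : m.-tuple helt) : bzcochain := l_of phi x.

Lemma v_of_ext (f g : seq helt -> barcochain) x :
  (forall y, (0 < size y < size x)%N -> f y = g y) -> v_of f x = v_of g x.
Proof.
move=> fg; apply: functional_extensionality => c; apply: eq_big_nat => t.
move=> /andP[t0 tx]; apply: eq_bigr => s _ /=.
have sz : size (hatp s) = size x by rewrite size_map size_enum_ord.
have st : size (take t (hatp s)) = t by rewrite size_takel // sz ltnW.
rewrite !fg // ?st ?t0 // size_drop sz subn_gt0 tx ltn_subrL t0.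
by rewrite (ltn_trans t0).
Qed.

Lemma u_of_ext (f g : seq helt -> barcochain) x :
  (forall y, (0 < size y < size x)%N -> f y = g y) -> u_of f x = u_of g x.
Proof.
move=> fg; apply: functional_extensionality => c; apply: eq_big_nat => r.
move=> /andP[r1 rx]; apply: eq_bigr => s _ /=.
have sz : size (hatp s) = size x by rewrite size_map size_enum_ord.
have sr : size (take r (hatp s)) = r by rewrite size_takel // sz.
have -> : l_of f (take r (hatp s)) = l_of g (take r (hatp s)).
  rewrite /l_of (@v_of_ext f g) // => y; rewrite sr => /andP[y0 yr].
  by apply: fg; rewrite y0 (leq_trans yr).
rewrite fg // [size _]/= size_drop sz.
apply/andP; split=> //; by rewrite -[X in (_ < X)%N](subnK (ltnSE rx)) -addn1 ltn_add2l.
Qed.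

Lemma phi_upto_stable N x : (0 < size x <= N)%N -> phi_upto N x = phi x.
Proof.
rewrite /phi; elim: {N}N.+1 {-2}N (ltnSn N) x => // M IH N NM x.
case: x => [|y [|z x]]; [by []|by case: N NM|].
case: N NM => [|N] NM xN; first by case/andP: xN.
 rewrite /phi_upto -/phi_upto.
have {}xN : (size [:: z & x] <= N)%N by case/andP: xN.
have fg y' : (0 < size y' < size [:: y, z & x])%N ->
    phi_upto N y' = phi_upto (size [:: z & x]) y'.
  move=> /andP[y0 sy]; rewrite (IH N) ?y0 ?(leq_trans (ltnSE sy)) //.
  by rewrite (IH (size [:: z & x])) ?y0 //; apply: leq_ltn_trans xN _.
by rewrite (u_of_ext fg) (v_of_ext fg).
Qed.

Lemma phiE x : (1 < size x)%N ->
  phi x = Hup (fun c => u_of phi x c + v_of phi x c).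
Proof.
case: x => [|y [|z x]]; [by []|by []|move=> _].
have fg y' : (0 < size y' < size [:: y, z & x])%N ->
    phi_upto (size [:: z & x]) y' = phi y' by move/phi_upto_stable.
rewrite -(u_of_ext fg) -(v_of_ext fg); exact: erefl.
Qed.

End Monomial.

Definition Rn (Q : quiver) (n : nat) : pred (qpath Q) := fun p => plen p == n.

Section Truncated.
Variables (k : fieldType) (Q : quiver).

Local Notation kQ := {malg k[qpath Q]}.

Definition kQmul (x y : kQ) : kQ :=
  lin (fun p => lin (fun q =>
    if composable [:: p; q] then << pcat p q >> else 0) y) x.

Inductive J : kQ -> Prop :=
| J_arr p of plen p = 1%N : J << p >>
| J_0 : J 0
| J_add x y of J x & J y : J (x + y)
| J_mull x y of J y : J (kQmul x y)
| J_mulr x y of J x : J (kQmul x y).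

Inductive ideal_mul (I1 I2 : kQ -> Prop) : kQ -> Prop :=
| IM_mul x y of I1 x & I2 y : ideal_mul I1 I2 (kQmul x y)
| IM_0 : ideal_mul I1 I2 0
| IM_add x y of ideal_mul I1 I2 x & ideal_mul I1 I2 y : ideal_mul I1 I2 (x + y).

Fixpoint Jpow (n : nat) : kQ -> Prop :=
  if n is n'.+1 then ideal_mul (Jpow n') J else fun=> True.

Lemma plen_pcat (p q : qpath Q) :
  composable [:: p; q] -> plen (pcat p q) = (plen p + plen q)%N.
Proof.
rewrite /= andbT => /eqP pq; rewrite /plen /parr /pcat val_insubd /=.
rewrite walk_cat -/(ptgt p) pq (valP p) (valP q) /=; by rewrite size_cat.
Qed.

Lemma redE n (p : qpath Q) : red (Rn n) p = (plen p < n)%N.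
Proof.
rewrite /red /inI negbK; apply/eqP/idP => [occ0|pn].
  rewrite ltnNge; apply/negP => np.
  have : (0, n)%N \in occs (Rn n) p.
    rewrite mem_filter; apply/andP; split.
      by rewrite /Rn /plen /parr /= drop0 size_takel.
    by apply: allpairs_f; rewrite mem_iota ?add0n ?ltnS.
  by rewrite occ0.
apply/eqP; rewrite -[_ == _]negbK -has_filter; apply/hasPn => -[i j] _ /=.
apply/negP => /andP[_ /eqP]; rewrite {1}/plen /parr /= size_drop => E.
move: pn; rewrite ltnNge -E (leq_trans (leq_subr _ _)) //.
by rewrite size_take_min geq_minr.
Qed.

Lemma linD (T : choiceType) (M : lmodType k) (f : T -> M) :
  {morph lin f : x y / x + y}.
Proof.
move=> x y; pose D := (msupp x `|` msupp y `|` msupp (x + y))%fset.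
have linE z : (msupp z `<=` D)%fset -> lin f z = \sum_(i <- D) z@_i *: f i.
  move=> zD; rewrite /lin; apply: (big_fset_incl _ zD) => i _.
  by move/mcoeff_outdom => ->; rewrite scale0r.
have xD : (msupp x `<=` D)%fset by rewrite /D -fsetUA fsubsetUl.
have yD : (msupp y `<=` D)%fset by rewrite /D fsetUAC fsubsetUr.
rewrite !linE ?fsubsetUr //.
by rewrite -big_split; apply: eq_bigr => i _; rewrite mcoeffD scalerDl.
Qed.

Lemma malgZU (T : choiceType) (c : k) (t : T) :
  c *: << t >> = << c *g t >> :> {malg k[T]}.
Proof. by apply: (malgP _ _).1 => v; rewrite mcoeffZ !mcoeffU mulr_natr. Qed.

Lemma lin0 (T : choiceType) (M : lmodType k) (f : T -> M) : lin f 0 = 0.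
Proof. by rewrite /lin msupp0 big_nil. Qed.

Lemma linU (T : choiceType) (M : lmodType k) (f : T -> M) c i :
  lin f << c *g i >> = c *: f i.
Proof.
rewrite /lin msuppU; case: eqP => [->|_]; first by rewrite big_nil scale0r.
by rewrite big_seq_fset1 mcoeffUU.
Qed.

(* A = kQ/J^n: the linear map kQ -> A sending a path to its class is onto
   (cls_surj), has kernel J^n (cls_ker) and is compatible with the products
   (sandE). *)
Lemma cls_surj n (a : {malg k[{p : qpath Q | red (Rn n) p}]}) :
  exists x : kQ, lin (cls k (Rn n)) x = a.
Proof.
exists (\sum_(u <- msupp a) << a@_u *g val u >>).
rewrite (big_morph _ (linD _) (lin0 _)) [RHS]monalgE; apply: eq_bigr => u _.
rewrite linU /cls /elt valK.
exact: malgZU.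
Qed.

Lemma Jpow_plen n x p : Jpow n x -> x@_p != 0 -> (n <= plen p)%N.
Proof.
pose S m (x : kQ) := forall p, x@_p != 0 -> (m <= plen p)%N.
have S0 m : S m 0 by move=> q; rewrite mcoeff0 eqxx.
have SD m y z : S m y -> S m z -> S m (y + z).
  move=> Sy Sz q; rewrite mcoeffD; have [y0|/Sy //] := eqVneq y@_q 0.
  by rewrite y0 add0r => /Sz.
have SM m1 m2 y z : S m1 y -> S m2 z -> S (m1 + m2)%N (kQmul y z).
  move=> Sy Sz; rewrite /kQmul /lin big_seq; elim/big_ind: _ => // [|q /= yq].
    exact: SD.
  rewrite scaler_sumr big_seq; elim/big_ind: _ => // [|r /= zr].
    exact: SD.
  case: ifP => [qr|_]; last by rewrite !scaler0.
  move=> t; rewrite !mcoeffZ mcoeffU; have [<- _|_] := eqVneq _ t; last first.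
    by rewrite mulr0n !mulr0 eqxx.
  by rewrite plen_pcat //; apply: leq_add; [apply: Sy|apply: Sz];
    rewrite mcoeff_neq0.
have SJ y : J y -> S 1%N y.
  elim=> // [q q1|a b _ Sa _ Sb|a b _ Sb|a b _ Sa]; first last.
  - by rewrite -[1%N]addn0; apply: SM.
  - by rewrite -[1%N]add0n; apply: SM.
  - exact: SD.
  move=> r; rewrite mcoeffU; have [<-|_] := eqVneq q r; first by rewrite q1.
  by rewrite eqxx.
suff SJn m y : Jpow m y -> S m y by move/SJn; apply.
elim: m y => [|m IH] y //= ; elim=> // [a b /IH Sa /SJ Sb|a b _ Sa _ Sb].
  by rewrite -addn1; apply: SM.
exact: SD.
Qed.

Lemma Jpow_path n c p : (n <= plen p)%N -> Jpow n << c *g p >>.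
Proof.
elim: n c p => // n IH c p np; pose m := (plen p).-1.
have Em : plen p = m.+1 by rewrite /m prednK // (leq_trans _ np).
have mp : (m < plen p)%N by rewrite Em.
have cmp : composable [:: ptake m p; pdrop m p] by rewrite /= eqxx.
have -> : << c *g p >> = kQmul << c *g ptake m p >> << pdrop m p >>.
  rewrite /kQmul !linU cmp scale1r.
  have -> : pcat (ptake m p) (pdrop m p) = p.
    apply: val_inj; rewrite val_insubd /= cat_take_drop.
    have -> : (psrc p, parr p) = val p by rewrite [RHS]surjective_pairing.
    by rewrite (valP p).
  by rewrite malgZU.
apply: IM_mul.
  by apply: IH; rewrite /plen /parr /= size_takel ?(ltnW mp) // -ltnS -Em.
by apply: J_arr; rewrite /plen /parr /= size_drop -/(parr p) -/(plen p) Em subSnn.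
Qed.

Lemma cls_coef n (u : {p : qpath Q | red (Rn n) p}) q :
  (cls k (Rn n) q)@_u = (val u == q)%:R.
Proof.
rewrite /cls /elt; case: insubP => [w _ <-|nq].
  by rewrite mcoeffU val_eqE [w == u]eq_sym.
rewrite mcoeff0; have [E|//] := eqVneq (val u) q.
by rewrite -E (valP u) in nq.
Qed.

Lemma cls_ker n (x : kQ) : lin (cls k (Rn n)) x = 0 <-> Jpow n x.
Proof.
split=> [x0|Jx].
  rewrite [x]monalgE big_seq; elim/big_ind: _ => [|y z Jy Jz|p xp].
  - by case: n {x0} => //= n; apply: IM_0.
  - by case: n {x0} Jy Jz => //= n; apply: IM_add.
  apply: Jpow_path; rewrite leqNgt -redE; apply/negP => pn.
  pose u : {p : qpath Q | red (Rn n) p} := exist _ p pn.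
  have : (lin (cls k (Rn n)) x)@_u = 0 by rewrite x0 mcoeff0.
  rewrite /lin raddf_sum (bigD1_seq p) ?uniq_fset_keys // big1.
    rewrite /= addr0 mcoeffZ cls_coef eqxx mulr1 => /eqP.
    by rewrite mcoeff_eq0 xp.
  move=> q qp; rewrite /= mcoeffZ cls_coef /=.
  by rewrite [_ == _]eq_sym (negbTE qp) mulr0.
rewrite /lin big_seq big1 // => p xp; rewrite /cls /elt insubF ?scaler0 //.
apply/negbTE; rewrite redE -leqNgt; apply: Jpow_plen Jx _.
by rewrite mcoeff_neq0.
Qed.

Lemma ptgt_pcat (p q : qpath Q) : composable [:: p; q] -> ptgt (pcat p q) = ptgt q.
Proof.
rewrite /= andbT => /eqP pq.
have E : val (pcat p q) = (psrc p, parr p ++ parr q).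
  by rewrite val_insubd /= walk_cat -/(ptgt p) pq (valP p) (valP q).
rewrite /ptgt /psrc /parr -!/(val _) E /wend /= map_cat last_cat.
by rewrite -[last _ (map _ (pval p).2)]/(ptgt p) pq.
Qed.

Lemma sandE n (p q : qpath Q) (x : kQ) :
  lin (cls k (Rn n)) (kQmul (kQmul << p >> x) << q >>) =
  sand p (lin (cls k (Rn n)) x) q.
Proof.
pose M (y : kQ) : kQ :=
  lin (fun r => if composable [:: p; r] then << pcat p r >> else 0) y.
have mulM y : kQmul << p >> y = M y by rewrite /kQmul linU scale1r.
pose N (y : kQ) : kQ := kQmul y << q >>.
pose cl := lin (cls k (Rn n)) : kQ -> _.
pose lhs y := cl (N (M y)); pose rhs y := sand p (cl y) q.
rewrite mulM -[LHS]/(lhs x) -[RHS]/(rhs x).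
have lhsD : {morph lhs : y z / y + z}.
  by move=> y z; rewrite /lhs /M linD /N /kQmul linD /cl linD.
have rhsD : {morph rhs : y z / y + z}.
  by move=> y z; rewrite /rhs /cl linD /sand linD.
have lhs0 : lhs 0 = 0 by rewrite /lhs /M lin0 /N /kQmul lin0 /cl lin0.
have rhs0 : rhs 0 = 0 by rewrite /rhs /cl lin0 /sand lin0.
rewrite [x]monalgE (big_morph _ lhsD lhs0) (big_morph _ rhsD rhs0).
apply: eq_bigr => r _; rewrite /lhs /rhs {2}/cl linU /M linU.
have comp3 : composable [:: p; r; q] =
    composable [:: p; r] && composable [:: r; q] by rewrite /= !andbT.
have plen3 : composable [:: p; r; q] -> (plen r <= plen (pcat (pcat p r) q))%N.
  rewrite comp3 => /andP[pr rq]; rewrite !plen_pcat //.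
    by rewrite addnAC leq_addl.
  by move: rq; rewrite /= ptgt_pcat.
have cpr : composable [:: p; r] ->
    composable [:: pcat p r; q] = composable [:: p; r; q].
  by move=> pr; rewrite comp3 pr /= ptgt_pcat.
have -> : cl (N (x@_r *:
    (if composable [:: p; r] then << pcat p r >> else 0))) =
    x@_r *: (if composable [:: p; r; q] then cls k (Rn n) (pcat (pcat p r) q)
             else 0).
  case: ifP => [pr|pr]; last first.
    by rewrite comp3 pr !scaler0 /N /kQmul lin0 /cl lin0.
  rewrite malgZU /N /kQmul linU linU scale1r (cpr pr).
  case: ifP => _; first by rewrite malgZU /cl linU.
  by rewrite !scaler0 /cl lin0.
rewrite [cls _ _ r]/cls /elt; case: insubP => [u _ ur|nr].
  by rewrite malgZU /sand linU ur.
rewrite scaler0 /sand lin0; case: ifP => [c3|]; last by rewrite scaler0.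
rewrite /cls /elt insubF ?scaler0 //; apply/negbTE.
by move: nr; rewrite !redE -!leqNgt => nr; rewrite (leq_trans nr) // plen3.
Qed.

End Truncated.

(* Main.v *)
Require Import Defs.
From mathcomp Require Import all_boot all_order all_algebra all_fingroup.
From mathcomp Require Import finmap monalg zify.

Set Implicit Arguments.
Unset Strict Implicit.
Unset Printing Implicit Defensive.

Import GRing.Theory.
Local Open Scope ring_scope.

(** The proof only looks at the lengths of the bar factors that can occur; no
    sign and no coefficient is ever computed.

    When x consists of elements of degree 1, [phi x] is a 2-cochain
    ([phi_conc2]), so that the brackets in v_m only involve the composites
    f(g(w, u), b) and f(w, g(u, b)).  The paths of AP_3 have length n + 1, and
    F_3 sends them into the span of the elements a_0 [w | u | b] a_1 with w and b
    arrows ([F3_lens]).  As l_m = F^* v_m for m >= 2, it is enough that v_m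
    vanishes on such triples (w, u, b).

    Since the homotopy s kills the elements 1 (x) x, the recursion for H loses all
    its terms but one, and for v' = b_1 ... b_l one gets, up to sign,
      H_2 (1 [v | v'] 1) =
        sum_(i >= 2) 1 [v | b_1 ... b_(i-1) | b_i] b_(i+1) ... b_l.
    For s >= 2, phi_s = H^* (u_s + v_s), and this formula has two consequences:
    - phi_s (u, b) = 0 when b is an arrow, the sum being empty
      ([phi_arrow_right]);
    - phi_s (a, v) = 0 when a is an arrow ([phi_arrow_left]).  Here the sum
      involves (u_s + v_s) (a, u, b) with b an arrow and |u| + 1 < n.  The
      cochain u_s is a combination of values of phi, and the degree 3 component
      of any value of phi is zero on (a, u, b): the path u b is not in I, so
      G_3 and H_3 are zero there ([phi_short3]).  The composites in v_s vanish
      by the first consequence, by induction on s, or because phi_1 = G^* is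
      zero at (a, u) and (u, b) unless a u, resp. u b, is in I.

    If m >= 3, one of the two factors phi_t, phi_(m-t) of each bracket in v_m has
    at least two arguments.  If it is the inner one, it is evaluated at (w, u) or
    at (u, b); if it is the outer one, at (-, b) or at (w, -).  It is zero in
    every case. *)

(** * Supports of linear combinations *)

Section Support.
Variables (k : fieldType) (T : choiceType) (P : pred T).
Local Notation V := {malg k[{x : T | P x}]}.

Definition supp (S : T -> Prop) (x : V) := forall y, y \in msupp x -> S (val y).

Lemma supp_mono S S' x : (forall y, P y -> S y -> S' y) -> supp S x -> supp S' x.
Proof. by move=> SS Sx y yx; apply: SS (valP y) (Sx _ yx). Qed.

Lemma suppI S S' x :
  supp S x -> supp S' x -> supp (fun y => S y /\ S' y) x.
Proof. by move=> Sx S'x y yx; split; [apply: Sx|apply: S'x]. Qed.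

Lemma supp_void S x : (forall y, P y -> S y -> False) -> supp S x -> x = 0.
Proof.
move=> nS Sx; apply: (malgP _ _).1 => y; rewrite mcoeff0.
by apply: mcoeff_outdom; apply/negP => /Sx; apply: nS (valP y).
Qed.

Lemma supp0 S : supp S 0.
Proof. by move=> y; rewrite msupp0. Qed.

Lemma suppD S x y : supp S x -> supp S y -> supp S (x + y).
Proof.
move=> Sx Sy z zxy; have := fsubsetP (msuppD_le x y) z zxy.
by rewrite in_fsetU => /orP[/Sx|/Sy].
Qed.

Lemma suppN S x : supp S x -> supp S (- x).
Proof. by move=> Sx y; rewrite msuppN; apply: Sx. Qed.

Lemma suppZ S c x : supp S x -> supp S (c *: x).
Proof. by move=> Sx y yx; apply: Sx (fsubsetP (msuppZ_le c x) y yx). Qed.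

Lemma supp_elt S t : (P t -> S t) -> supp S (elt k P t).
Proof.
move=> St y; rewrite /elt; case: insubP => [u Pt ut|_]; last by rewrite msupp0.
move=> /(fsubsetP msuppU_le); rewrite in_fset1 => /eqP ->.
by rewrite ut; apply: St.
Qed.

Lemma supp_sum S (I : Type) (r : seq I) (Q : pred I) F :
  (forall i, Q i -> supp S (F i)) -> supp S (\sum_(i <- r | Q i) F i).
Proof.
by move=> SF; apply: big_ind => //; [apply: supp0|apply: suppD].
Qed.

Lemma supp_sum_seq S (I : eqType) (r : seq I) (Q : pred I) F :
  (forall i, i \in r -> Q i -> supp S (F i)) -> supp S (\sum_(i <- r | Q i) F i).
Proof.
move=> SF; rewrite big_seq_cond; apply: supp_sum => i /andP[ir Qi]; exact: SF.
Qed.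

End Support.

Lemma supp_lin (k : fieldType) (T T' : choiceType) (P : pred T) (P' : pred T')
  (S : T -> Prop) (S' : T' -> Prop)
  (f : {x : T | P x} -> {malg k[{x : T' | P' x}]}) x :
  supp S x -> (forall y, S (val y) -> supp S' (f y)) -> supp S' (lin f x).
Proof.
move=> Sx Sf; rewrite /lin; apply: supp_sum_seq => y yx _.
by apply: suppZ; apply: Sf; apply: Sx.
Qed.

Lemma lin_eq0 (k : fieldType) (T : choiceType) (P : pred T) (M : lmodType k)
  (S : T -> Prop) (f : {x : T | P x} -> M) x :
  supp S x -> (forall y, S (val y) -> f y = 0) -> lin f x = 0.
Proof.
move=> Sx f0; rewrite /lin big_seq big1 // => y yx.
by rewrite f0 ?scaler0 //; apply: Sx.
Qed.

Lemma lin_supp (k : fieldType) (T T' : choiceType) (P : pred T) (P' : pred T')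
  (S' : T' -> Prop) (f : {x : T | P x} -> {malg k[{x : T' | P' x}]}) x :
  (forall y, supp S' (f y)) -> supp S' (lin f x).
Proof. by move=> Sf; rewrite /lin; apply: supp_sum => y _; apply: suppZ. Qed.

Lemma ext0_eq0 (T : choiceType) (P : pred T) (M : zmodType)
  (f : {x : T | P x} -> M) t : (forall u, val u = t -> f u = 0) -> ext0 f t = 0.
Proof. by move=> f0; rewrite /ext0; case: insubP => // u _ /f0. Qed.

(** * Occurrences of subpaths, and AP_2 and AP_3 for truncated algebras *)

Section PathFacts.
Variables (Q : quiver).
Local Notation path := (qpath Q).

Lemma plen_pcat_le (p q : path) : (plen (pcat p q) <= plen p + plen q)%N.
Proof.
rewrite /plen /parr /pcat val_insubd; case: ifP => _ /=; first by rewrite size_cat.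
exact: leq_addr.
Qed.

Lemma plen_ptake i (p : path) : plen (ptake i p) = minn i (plen p).
Proof. by rewrite /plen /parr /= size_take_min. Qed.

Lemma plen_psub (p : path) i j : plen (psub p i j) = (minn j (plen p) - i)%N.
Proof. by rewrite /plen /parr /= size_drop size_take_min. Qed.

Lemma mem_occs (P : pred path) T ij : (ij \in occs P T) =
  [&& (ij.1 <= ij.2)%N, (ij.2 <= plen T)%N & P (psub T ij.1 ij.2)].
Proof.
rewrite mem_filter; case: ij => i j /=.
have -> : ((i, j) \in [seq (i, j) | i <- iota 0 (plen T).+1,
    j <- iota 0 (plen T).+1]) = (i <= plen T)%N && (j <= plen T)%N.
  apply/allpairsP/andP => [[[a b] [ha hb [-> ->]]]|[ha hb]].
    by move: ha hb; rewrite !mem_iota !add0n !ltnS.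
  by exists (i, j); rewrite !mem_iota !add0n !ltnS.
case: (leqP i j) => //= ij; case: (leqP j _) => jT; rewrite ?andbF //=.
by rewrite (leq_trans ij jT) ?andbT.
Qed.

(** This is what makes the choices of minimal source in AP_j, and in G_j for
    even j, minimal: both take the head of a sublist of [occs P T]. *)
Lemma occs_sorted (P : pred path) T :
  pairwise (fun a b : nat * nat => a.1 <= b.1)%N (occs P T).
Proof.
rewrite /occs; set r := (fun a b => _); apply: (subseq_pairwise (filter_subseq _ _)).
have pr s t : pairwise leq s -> pairwise r [seq (i, j) | i <- s, j <- t].
  elim: s => //= i s IH /andP[/allP is_ /IH ps].
  rewrite pairwise_cat ps andbT; apply/andP; split.
    by apply/allrelP => a b /mapP[j _ ->] /allpairsP[[i' j'] [/is_ ii' _ ->]].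
  rewrite pairwise_map; elim: t {ps IH} => //= j t ->.
  by rewrite andbT; apply/allP => ? _; apply: leqnn.
by apply: pr; rewrite -sorted_pairwise ?iota_sorted //; apply: leq_trans.
Qed.

Lemma ohead_filter_occs (P : pred path) T (C : pred (nat * nat)) q ij :
  ohead [seq p <- occs P T | C p] = Some q -> ij \in occs P T -> C ij ->
  (q.1 <= ij.1)%N.
Proof.
move=> hq ijP Cij; have := occs_sorted P T.
move/(subseq_pairwise (filter_subseq C _)).
have : ij \in [seq p <- occs P T | C p] by rewrite mem_filter Cij.
case: [seq p <- _ | _] hq => //= x s [->]; rewrite inE => /orP[/eqP -> //|].
by move=> ijs /andP[/allP /(_ _ ijs)].
Qed.

Variable n : nat.
Hypothesis n_gt0 : (0 < n)%N.
Local Notation R := (@Rn Q n).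

Lemma mem_occs_Rn T ij :
  (ij \in occs R T) = (ij.2 == ij.1 + n)%N && (ij.2 <= plen T)%N.
Proof. by rewrite mem_occs /Rn plen_psub; lia. Qed.

Lemma AP2E w : AP R 2 w = (plen w == n).
Proof.
apply/hasP/eqP => [[[i j]]|wn]; rewrite /= ?mem_occs_Rn /=.
  by move=> ij /andP[i0 /eqP[jw]]; lia.
by exists (0, n)%N; rewrite ?mem_occs_Rn /= wn ?eqxx /=.
Qed.

(** All subpaths of length n are relations, so the one of minimal source after
    the first starts one arrow later. *)
Lemma AP3_plen w : AP R 3 w -> plen w = n.+1.
Proof.
move=> /hasP[[i j]]; rewrite mem_occs_Rn /= /next_rel => ij /andP[i0].
case E: ohead => [[a b]|] //= /eqP[bw].
have : (a, b) \in [seq q <- occs R w | (i < q.1 < j)%N].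
  by case: [seq q <- _ | _] E => //= c s [->]; rewrite mem_head.
rewrite mem_filter mem_occs_Rn /= => ab.
have := ohead_filter_occs (ij := (1, n.+1)%N) E.
by rewrite mem_occs_Rn /=; lia.
Qed.

End PathFacts.

Arguments F_gen : simpl never.
Arguments H_gen : simpl never.
Arguments G_gen : simpl never.
Arguments bzd_gen : simpl never.
Arguments circ : simpl never.

(** * Supports of the comparison maps of a monomial algebra *)

Section Monomial.
Variables (k : fieldType) (Q : quiver) (R : pred (qpath Q)).
Local Notation path := (qpath Q).
Local Notation bar := {malg k[{x : path * seq path * path | bar_basis R x}]}.
Local Notation bz := {malg k[{x : path * (nat * path) * path | bz_basis R x}]}.
Local Notation tri := (path * seq path * path)%type.

Lemma supp_baract (S : tri -> Prop) p (x : bar) q :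
  supp (fun y => S (pcat p y.1.1, y.1.2, pcat y.2 q)) x ->
  supp S (baract p x q).
Proof.
move=> Sx; apply: (supp_lin Sx) => -[[[a v] b] ab] /= Sy.
by case: ifP => _; [apply: supp_elt|apply: supp0].
Qed.

Lemma supp_bars (S : tri -> Prop) (x : bar) :
  supp (fun y => (0 < plen y.1.1)%N ->
    S (triv (psrc y.1.1), y.1.1 :: y.1.2, y.2)) x ->
  supp S (bars x).
Proof.
move=> Sx; apply: (supp_lin Sx) => -[[[a v] b] ab] /= Sy.
apply: supp_elt => /and4P[_ _ _ /= /andP[/andP[_ a0] _]]; exact: Sy.
Qed.

(** The elements 1 (x) x, which the homotopy s kills; only the triviality of the
    left coefficient is recorded. *)
Definition unital (y : tri) := plen y.1.1 = 0%N.

Lemma bars_unital (x : bar) : supp unital (bars x).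
Proof. by apply: supp_bars => y _ _. Qed.

Lemma bars_eq0 (x : bar) : supp unital x -> bars x = 0.
Proof.
move=> x1; apply: (@supp_void _ _ _ (fun=> False)) => //; apply: supp_bars.
by apply: supp_mono x1 => y _ ->.
Qed.

Lemma supp_bzact S p (x : bz) q :
  supp (fun y => S (pcat p y.1.1, y.1.2, pcat y.2 q)) x ->
  supp S (bzact p x q).
Proof.
move=> Sx; apply: (supp_lin Sx) => -[[[a v] b] ab] /= Sy.
by case: ifP => _; [apply: supp_elt|apply: supp0].
Qed.

Lemma supp_F (S : tri -> Prop) (x : bz) :
  supp (fun y => supp (fun z => S (pcat y.1.1 z.1.1, z.1.2, pcat z.2 y.2))
                      (F_gen k R y.1.2.1 y.1.2.2)) x ->
  supp S (F x).
Proof.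
by move=> Sx; apply: (supp_lin Sx) => -[[[a v] b] ab] /= Sy; apply: supp_baract.
Qed.

Lemma F_gen_unital j w : (0 < j)%N -> supp unital (F_gen k R j w).
Proof. by case: j => //= j _; apply: bars_unital. Qed.

Lemma H_gen_unital j ev : supp unital (H_gen k R j ev).
Proof.
case: j ev => [|j] [e v]; first exact: supp0.
by apply: suppD; [|apply: suppN]; apply: bars_unital.
Qed.

(** The recursion, in a form in which the value of degree j stays folded. *)
Lemma H_genS j e v (x := barelt k R (triv e, v, triv (last e (map (@ptgt Q) v)))) :
  H_gen k R j.+1 (e, v) = bars (F (G x)) -
    bars (lin (fun y => let: (a, v, b) := val y in
                 baract a (H_gen k R j (ptgt a, v)) b) (bard x)).
Proof. by []. Qed.

Lemma supp_G (S : path * (nat * path) * path -> Prop) (x : bar) :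
  supp (fun y => supp (fun z => S (pcat y.1.1 z.1.1, z.1.2, pcat z.2 y.2))
                      (G_gen k R (ptgt y.1.1, y.1.2))) x ->
  supp S (G x).
Proof.
by move=> Sx; apply: (supp_lin Sx) => -[[[a v] b] ab] /= Sy; apply: supp_bzact.
Qed.

Lemma supp_bzd_gen (S : path * (nat * path) * path -> Prop) j w :
  (forall i i', (i <= i' <= plen w)%N -> AP R j (psub w i i') ->
    (odd j.+1 -> i' = plen w \/ i = 0%N) ->
    S (ptake i w, (j, psub w i i'), pdrop i' w)) ->
  supp S (bzd_gen k R j.+1 w).
Proof.
move=> Sw; have St ij : ij \in occs (AP R j) w ->
    (odd j.+1 -> ij.2 = plen w \/ ij.1 = 0%N) ->
    supp S (bzelt k R (ptake ij.1 w, (j, psub w ij.1 ij.2), pdrop ij.2 w)).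
  rewrite mem_occs => /and3P[ii' i'w APj] oj; apply: supp_elt => _.
  by apply: Sw => //; rewrite ii'.
rewrite /bzd_gen; case: ifP => odj; last first.
  by apply: supp_sum_seq => ij /St + _; apply; rewrite odj.
apply: suppD; [|apply: suppN]; apply: supp_sum_seq => ij /St + /eqP E; apply.
  by left.
by right.
Qed.

Lemma supp_G_gen (S : path * (nat * path) * path -> Prop) e v :
  (forall i i', let T := foldl (@pcat Q) (triv e) v in
    G_cond R v -> (i <= i' <= plen T)%N -> AP R (size v) (psub T i i') ->
    (odd (size v) -> (i < plen (head T v))%N) ->
    (~~ odd (size v) ->
       forall ij, ij \in occs (AP R (size v)) T -> (i <= ij.1)%N) ->
    S (ptake i T, (size v, psub T i i'), pdrop i' T)) ->
  supp S (G_gen k R (e, v)).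
Proof.
rewrite /G_gen; set T := foldl _ _ _ => Sv.
case: ifPn => [_|/negbNE gv]; first exact: supp0.
case: ifP Sv => odv Sv.
  apply: supp_sum_seq => ij; rewrite mem_occs => /and3P[ii' i'T APv] iv.
  by apply: supp_elt => _; apply: Sv; rewrite ?ii'.
have := occs_sorted (AP R (size v)) T.
case E : occs => [|ij s]; first by move=> _; apply: supp0.
move=> /= /andP[/allP ijs _]; apply: supp_elt => _.
have: ij \in occs (AP R (size v)) T by rewrite E mem_head.
rewrite mem_occs => /and3P[ii' i'T APv]; apply: Sv => //; rewrite ?ii' //.
by move=> _ ij'; rewrite E inE => /orP[/eqP -> //|/ijs].
Qed.

Definition bar_deg j (y : tri) := size y.1.2 = j.

Lemma F_gen_deg j w : supp (bar_deg j) (F_gen k R j w).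
Proof.
elim: j w => [|j IH] w; first by apply: supp_elt.
apply: supp_bars.
apply: lin_supp => -[[[a [j' w']] b] ab] /=; apply: supp_baract.
by apply: supp_mono (IH w') => -[[a' v'] b'] _ /= E _; rewrite /bar_deg /= E.
Qed.

Lemma F_deg j x : supp (fun y => y.1.2.1 = j) x -> supp (bar_deg j) (F x : bar).
Proof.
by move=> xj; apply: supp_F; apply: supp_mono xj => y _ <-; apply: F_gen_deg.
Qed.

Lemma G_gen_deg e v : supp (fun y => y.1.2.1 = size v) (G_gen k R (e, v)).
Proof. exact: supp_G_gen. Qed.

Lemma G_deg j x : supp (bar_deg j) x -> supp (fun y => y.1.2.1 = j) (G x : bz).
Proof.
by move=> xj; apply: supp_G; apply: supp_mono xj => y _ <-; apply: G_gen_deg.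
Qed.

Lemma size_merge_at i (v : seq path) : (i.+1 < size v)%N ->
  size (merge_at i v) = (size v).-1.
Proof. by elim: v i => // p [|q v] IH [|i] //= iv; rewrite IH. Qed.

Lemma bard_deg j x : supp (bar_deg j.+1) x -> supp (bar_deg j) (bard x : bar).
Proof.
move=> xj; apply: (supp_lin xj) => -[[[a [|v1 v]] b] ab] //= [vj].
apply: suppD; [apply: suppD|apply: suppZ]; first by apply: supp_elt.
  apply: supp_sum_seq => i; rewrite mem_index_iota => /andP[i0 iv] _.
  apply: suppZ; apply: supp_elt => _.
  by rewrite /bar_deg [_.1.2]/= size_merge_at ?prednK //= vj.
by apply: supp_elt => _; rewrite /bar_deg /= size_belast.
Qed.

Lemma H_gen_deg j e v : size v = j -> supp (bar_deg j.+1) (H_gen k R j (e, v)).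
Proof.
elim: j e v => [|j IH] e v vj; first exact: supp0.
set x := barelt k R (triv e, v, triv (last e (map (@ptgt Q) v))).
have xj : supp (bar_deg j.+1) x by apply: supp_elt.
apply: suppD; [|apply: suppN]; apply: supp_bars.
  by apply: supp_mono (F_deg (G_deg xj)) => y _ yj _; rewrite /bar_deg /= yj.
apply: (supp_lin (bard_deg xj)) => -[[[a v'] b] ab] /= v'j; apply: supp_baract.
by apply: supp_mono (IH (ptgt a) v' v'j) => y _ yj _; rewrite /bar_deg /= yj.
Qed.

End Monomial.

(** * Lengths of the bar factors when I is the ideal of paths of length n *)

Section Truncated.
Variables (k : fieldType) (Q : quiver) (n : nat).
Hypothesis n_gt0 : (0 < n)%N.
Local Notation R := (@Rn Q n).
Local Notation path := (qpath Q).
Local Notation tri := (path * seq path * path)%type.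

Definition bar_lens (y : tri) := map (@plen Q) y.1.2.

(** With the positivity of bar factors, the one arrow available has to go
    entirely into the factor created by s. *)
Lemma F1_lens w :
  plen w = 1%N -> supp (fun y => bar_lens y = [:: 1%N]) (F_gen k R 1 w).
Proof.
move=> w1; apply: supp_bars.
have Sw : supp (fun y => y.1.2.1 = 0%N /\ (plen y.1.1 + plen y.1.2.2 <= 1)%N)
    (bzd_gen k R 1 w).
  apply: supp_bzd_gen => i i' _ /eqP /= ii' _; split=> //.
  by rewrite ii' plen_ptake w1; lia.
apply: (supp_lin Sw) => -[[[a [j w']] b] ab] /= [_ aw]; apply: supp_baract.
apply: supp_elt => _; rewrite /bar_lens /= => aw'.
suff -> : plen (pcat a w') = 1%N by [].
by have := plen_pcat_le a w'; lia.
Qed.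

Lemma F2_lens w : supp (fun y => exists l, bar_lens y = [:: l; 1%N]) (F_gen k R 2 w).
Proof.
apply: supp_bars.
have Sw : supp (fun y => AP R 1 y.1.2.2) (bzd_gen k R 2 w).
  by apply: supp_bzd_gen.
apply: (supp_lin Sw) => -[[[a [j w']] b] ab] /= /eqP w1; apply: supp_baract.
apply: supp_mono (F1_lens w1) => -[[a' v] b'] _; rewrite /bar_lens /= => -> _.
by eexists.
Qed.

(** In delta_3 (w), for w of length n + 1, the left coefficients have length at
    most 1, and s turns them into the first bar factor.  The bound on the
    middle factor holds in any bar element, as its factors are not in I. *)
Lemma F3_lens w : AP R 3 w ->
  supp (fun y => exists2 l, (l < n)%N & bar_lens y = [:: 1%N; l; 1%N])
    (F_gen k R 3 w).
Proof.
move=> /(AP3_plen n_gt0) wn; apply: supp_bars.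
have Sw : supp (fun y => plen y.1.1 <= 1)%N (bzd_gen k R 3 w).
  apply: supp_bzd_gen => i i' /andP[ii' i'w] + /(_ isT).
  by rewrite AP2E // plen_psub plen_ptake => /eqP; lia.
apply: (supp_lin Sw) => -[[[a [j w']] b] ab] /= a1; apply: supp_baract.
apply: supp_mono (suppI (F_gen_unital (isT : 0 < 2)%N) (@F2_lens w')) => y.
case: y => -[a' v] b'; rewrite /unital /bar_lens /= => + [a'0 [l vl]].
move=> /and4P[_ _ _]; case: v vl => [|u [|c []]] //= [_ ->].
move=> /andP[/andP[un _] _] a0; exists (plen u); first by rewrite -redE.
suff -> : plen (pcat a a') = 1%N by [].
by have := plen_pcat_le a a'; lia.
Qed.

(** H_1 = s F_1 G_1, and the left coefficients in G_1 (v) are the initial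
    subpaths which stop before some arrow of v: this is the strict bound. *)
Lemma H1_lens e v :
  supp (fun y => exists2 l, (l < plen v)%N & bar_lens y = [:: l; 1%N])
    (H_gen k R 1 (e, [:: v])).
Proof.
rewrite H_genS; apply: suppD; [|apply: suppN]; apply: supp_bars; last first.
  by apply: lin_supp => -[[[a u] b] ab] /=; apply: supp_baract; apply: supp0.
apply: supp_F; apply: supp_G; apply: supp_elt => _.
apply: supp_G_gen => i i' /= _ ii' /eqP w1 /(_ isT) iv _.
apply: supp_mono (suppI (F_gen_unital (isT : 0 < 1)%N) (F1_lens w1)) => y _.
case: y => -[a' u] b'; rewrite /unital /bar_lens /= => -[a'0 ->].
set a2 := ptake _ _; move=> _; eexists; last by [].
have := plen_pcat_le (pcat (triv e) a2) a'; have := plen_pcat_le (triv e) a2.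
rewrite plen_ptake a'0 add0n addn0 => le1 le2.
apply: leq_ltn_trans le2 _; apply: leq_ltn_trans le1 _.
exact: leq_ltn_trans (geq_minl _ _) iv.
Qed.

Lemma plen_pcat0 (p q : path) :
  plen p = 0%N -> plen q = 0%N -> plen (pcat p q) = 0%N.
Proof. by have := plen_pcat_le p q; lia. Qed.

(** The summand s F_2 G_2 is zero, because the divisor of minimal source chosen
    by G_2 is initial: this is special to the truncated case.  In the other
    summand s kills every term of d_2 but v1 (x) v2 (x) 1, which leaves
    s (v1 H_1 (v2)). *)
Lemma H2_lens e v1 v2 :
  supp (fun y => exists l1 l, [/\ (0 < l1 <= plen v1)%N, (l < plen v2)%N &
                                 bar_lens y = [:: l1; l; 1%N]])
    (H_gen k R 2 (e, [:: v1; v2])).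
Proof.
rewrite H_genS; apply: suppD; [|apply: suppN].
  rewrite bars_eq0; first exact: supp0.
  apply: supp_F; apply: supp_G; apply: supp_elt => _.
  apply: supp_G_gen => i i' T _ /andP[ii' i'T] + _ /(_ isT) imin.
  rewrite AP2E // plen_psub => /eqP in0.
  have /imin : (0, n)%N \in occs (AP R 2) T.
    by rewrite mem_occs AP2E // plen_psub /=; lia.
  rewrite leqn0 => /eqP i0.
  apply: (@supp_mono _ _ _ (@unital Q)); last exact: F_gen_unital.
  move=> y _ y0; apply: (plen_pcat0 _ y0); apply: plen_pcat0 => //.
  by rewrite plen_ptake i0 min0n.
apply: supp_bars.
apply: (supp_lin (S := fun y : tri =>
    plen y.1.1 = 0%N \/ (plen y.1.1 <= plen v1)%N /\ y.1.2 = [:: v2])).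
  apply: (supp_lin (S := fun y : tri => unital y /\ y.1.2 = [:: v1; v2])).
    by apply: supp_elt.
  move=> [[[a v] b] ab] /= [a0 ->].
  apply: suppD; [apply: suppD; [|apply: supp_sum_seq => i _ _]|];
    try apply: suppZ; apply: supp_elt => _ /=; try by left.
  by right; split=> //; rewrite (leq_trans (plen_pcat_le _ _)) // a0.
move=> [[[a v] b] ab] Sa; apply: supp_baract.
have {}Sa : plen a = 0%N \/ (plen a <= plen v1)%N /\ v = [:: v2] := Sa.
have H0 := @H_gen_unital k Q R 1 (ptgt a, v).
case: Sa H0 => [a0|[a1 ->]] H0.
  by apply: supp_mono H0 => y _ y0; rewrite /= plen_pcat0.
have H1 := @H1_lens (ptgt a) v2.
apply: supp_mono (suppI H0 H1) => y _ [y0 [l lv ly]] a0.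
exists (plen (pcat a y.1.1)), l; split=> //;
  last by move: ly; rewrite /bar_lens /= => ->.
by rewrite a0 (leq_trans (plen_pcat_le _ _)) // y0 addn0.
Qed.

(** A proper initial subpath of positive length does not exist in an arrow. *)
Lemma H2_eq0 e v1 v2 : plen v2 = 1%N -> H_gen k R 2 (e, [:: v1; v2]) = 0.
Proof.
move=> v2_1; apply: supp_void (@H2_lens e v1 v2) => -[[a v] b] /and4P[_ _ _].
case: v => [|u1 [|u2 [|u3 [|? ?]]]] /= + [l1 [l []]] //=; try by case.
rewrite v2_1 /bar_lens /= => /and3P[_ /andP[_ u2_0] _] _ l0 [_ ul _].
by move: u2_0; rewrite ul; move: l0; case: l {ul}.
Qed.

(** G_3 is zero on this element because v2 v3 is not in I, and the only
    surviving term of d_3 leads to H_2 (v2, v3), which is zero since v3 is an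
    arrow. *)
Lemma H3_eq0 e v1 v2 v3 : plen v3 = 1%N -> (plen v2 + 1 < n)%N ->
  H_gen k R 3 (e, [:: v1; v2; v3]) = 0.
Proof.
move=> v3_1 v2n; apply: (@supp_void _ _ _ (fun=> False)) => //.
rewrite H_genS; apply: suppD; [|apply: suppN].
  apply: supp_bars; apply: supp_F; apply: supp_G; apply: supp_elt => _.
  apply: supp_G_gen => i i' T /and3P[_ + _] _ _ _ _.
  rewrite -[inI R _]negbK -/(red R _) redE.
  by rewrite (leq_ltn_trans (plen_pcat_le _ _)) // v3_1.
rewrite bars_eq0; first exact: supp0.
apply: (supp_lin (S := fun y : tri => unital y \/ y.1.2 = [:: v2; v3])).
  apply: (supp_lin (S := fun y : tri => unital y /\ y.1.2 = [:: v1; v2; v3])).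
    by apply: supp_elt.
  move=> [[[a v] b] ab] /= [a0 ->].
  apply: suppD; [apply: suppD; [|apply: supp_sum_seq => i _ _]|];
    try apply: suppZ; apply: supp_elt => _ /=; try by left.
  by right.
move=> [[[a v] b] ab] Sa; apply: supp_baract.
have {}Sa : plen a = 0%N \/ v = [:: v2; v3] := Sa.
have H0 := @H_gen_unital k Q R 2 (ptgt a, v).
case: Sa H0 => [a0|->] H0; last by rewrite H2_eq0 //; apply: supp0.
by apply: supp_mono H0 => y _ y0; apply: plen_pcat0.
Qed.

End Truncated.

(** * Degrees of the cochains phi, v and l *)

Section Cochains.
Variables (k : fieldType) (Q : quiver) (R : pred (qpath Q)).
Local Notation path := (qpath Q).
Local Notation bar := {malg k[{x : path * seq path * path | bar_basis R x}]}.
Local Notation bz := {malg k[{x : path * (nat * path) * path | bz_basis R x}]}.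
Local Notation tri := (path * seq path * path)%type.
Local Notation cochain := (barcochain k R).

Lemma barhat_eq0 (S : tri -> Prop) (f : cochain) x : supp S x ->
  (forall y, S y -> ext0 f (ptgt y.1.1, y.1.2) = 0) -> barhat f x = 0.
Proof.
move=> Sx f0; apply: lin_eq0 Sx _ => -[[[a v] b] ab] /f0 /= ->.
exact: lin0.
Qed.

Lemma bzhat_eq0 S (f : bzcochain k R) x : supp S x ->
  (forall y, S y -> ext0 f y.1.2 = 0) -> bzhat f x = 0.
Proof.
move=> Sx f0; apply: lin_eq0 Sx _ => -[[[a v] b] ab] /f0 /= ->.
exact: lin0.
Qed.

(** Concentration of a cochain in one degree.  The degree is an integer
    because [dphi x] below can be negative; a cochain concentrated in a negative
    degree is zero. *)
Definition bar_conc (d : int) (f : cochain) :=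
  forall c, (size (val c).2)%:Z != d -> f c = 0.
Definition bz_conc (d : int) (f : bzcochain k R) :=
  forall w, (val w).1%:Z != d -> f w = 0.

Lemma ext0_bar_conc d f e v :
  bar_conc d f -> (size v)%:Z != d -> ext0 f (e, v) = 0.
Proof. by move=> fd vd; apply: ext0_eq0 => c cv; apply: fd; rewrite cv. Qed.

Lemma ext0_bz_conc d f w :
  bz_conc d f -> w.1%:Z != d -> ext0 f w = 0.
Proof. by move=> fd vd; apply: ext0_eq0 => c cv; apply: fd; rewrite cv. Qed.

Lemma circ_conc d1 d2 f g p q ev : bar_conc d1 f -> bar_conc d2 g ->
  (p + q)%N = (size ev.2).+1 -> (p%:Z != d1) || (q%:Z != d2) ->
  circ p q f g ev = 0.
Proof.
case: ev => e v /= fd gd pq npq; apply: big1 => i _.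
have sq : size (take q (drop i v)) = q.
  by rewrite size_takel // size_drop; have := ltn_ord i; lia.
case/orP: npq => [pd|qd]; last by rewrite (ext0_bar_conc _ gd) ?lin0 ?scaler0 ?sq.
rewrite (@lin_eq0 _ _ _ _ (fun=> True)) ?scaler0 // => a _.
apply: (ext0_bar_conc _ fd).
have -> // : size (take i v ++ val a :: drop (i + q) v) = p.
rewrite size_cat /= size_drop size_takel; have := ltn_ord i; lia.
Qed.

Lemma bracket_conc d1 d2 f g : bar_conc d1 f -> bar_conc d2 g ->
  bar_conc (d1 + d2 - 1) (bracket f g).
Proof.
move=> fd gd [[e v] cv] /= cd; apply: big1 => p _ /=.
have /= pv := ltn_ord p.
rewrite (circ_conc fd gd) /=; [|lia..].
by rewrite (circ_conc gd fd) /= ?scaler0 ?subr0 //; lia.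
Qed.

(** Of all the splittings of the arity in the bracket, only 2 + 2 is relevant
    for 2-cochains. *)
Lemma bracket22_eq0 f g c : bar_conc 2 f -> bar_conc 2 g ->
  circ 2 2 f g (val c) = 0 -> circ 2 2 g f (val c) = 0 ->
  bracket f g c = 0.
Proof.
move=> f2 g2; have [c3|c3] := eqVneq (size (val c).2) 3; last first.
  by move=> _ _; apply: (bracket_conc f2 g2); lia.
case: c c3 => [[e v] cv] /= c3 fg0 gf0.
apply: big1 => -[p pv] _ /=; move: pv; rewrite /= c3 => pv.
have [->|p2] := eqVneq p 2; first by rewrite fg0 gf0 scaler0 subr0.
rewrite (circ_conc f2 g2) /=; [|lia..].
by rewrite (circ_conc g2 f2) /= ?scaler0 ?subr0 //; lia.
Qed.

Lemma Gup_conc d f : bz_conc d f -> bar_conc d (@Gup k Q R f).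
Proof.
move=> fd [[e v] c] /= vd; apply: bzhat_eq0 (@G_gen_deg k Q R e v) _ => y yv.
by apply: (ext0_bz_conc fd); rewrite yv.
Qed.

Lemma Fup_conc d f : bar_conc d f -> bz_conc d (@Fup k Q R f).
Proof.
move=> fd [[j w] jw] /= jd; apply: barhat_eq0 (@F_gen_deg k Q R j w) _ => y yj.
by apply: (ext0_bar_conc _ fd); rewrite yj.
Qed.

Lemma Hup_conc d f : bar_conc d f -> bar_conc (d - 1) (@Hup k Q R f).
Proof.
move=> fd [[e v] c] /= vd; rewrite /Hup /=.
rewrite (barhat_eq0 (@H_gen_deg k Q R (size v) e v erefl)) ?scaler0 // => y yj.
apply: (ext0_bar_conc _ fd); rewrite yj; lia.
Qed.

Lemma concD d (f g : cochain) :
  bar_conc d f -> bar_conc d g -> bar_conc d (fun c => f c + g c).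
Proof. by move=> fd gd c cd; rewrite fd ?gd ?addr0. Qed.

Local Notation helt := (helt k R).
Local Notation zz := ((0, fun=> 0) : helt).

(** Stated with [nth]: neither P nor the equality of entries, which contain
    functions, is decidable. *)
Definition entries (P : helt -> Prop) (x : seq helt) :=
  forall i, (i < size x)%N -> P (nth zz x i).

Lemma entries_take P x t : entries P x -> entries P (take t x).
Proof.
move=> Px i; rewrite size_take_min leq_min => /andP[it ix].
by rewrite nth_take //; apply: Px.
Qed.

Lemma entries_drop P x t : entries P x -> entries P (drop t x).
Proof. by move=> Px i; rewrite size_drop nth_drop => ix; apply: Px; lia. Qed.

Lemma size_hatp (x : seq helt) s : size (hatp (x := x) s) = size x.
Proof. by rewrite size_map size_enum_ord. Qed.

Lemma entries_hatp P x (s : 'S_(size x)) : entries P x -> entries P (hatp s).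
Proof.
move=> Px i; rewrite size_hatp => ix.
rewrite (nth_map (Ordinal ix)) ?size_enum_ord //.
by apply: Px; apply: ltn_ord.
Qed.

Lemma entries_cons (P : helt -> Prop) z x : P z -> entries P x -> entries P (z :: x).
Proof. by move=> Pz Px [|i] //=; apply: Px. Qed.

Lemma sum_hatp (x : seq helt) (s : 'S_(size x)) :
  \sum_(z <- hatp s) z.1 = \sum_(z <- x) z.1.
Proof.
rewrite /hatp big_map big_enum /= (big_nth zz) big_mkord.
by rewrite [RHS](reindex_perm s).
Qed.

(** The announced degree z.1 is the one in the shifted complex B^*(A)[1]. *)
Definition homog (z : helt) := bz_conc (z.1 + 1) z.2.

(** phi_s has degree 1 - s for the shifted degrees. *)
Definition dphi (x : seq helt) : int := \sum_(z <- x) z.1 + 2 - (size x)%:Z.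

Lemma dphi_hatp x (s : 'S_(size x)) : dphi (hatp s) = dphi x.
Proof. by rewrite /dphi sum_hatp size_hatp. Qed.

Lemma dphi_split x t : dphi x = dphi (take t x) + dphi (drop t x) - 2.
Proof.
rewrite /dphi -{1 2}(cat_take_drop t x) big_cat size_cat PoszD /=.
by set a := \sum_(_ <- take _ _) _; set b := \sum_(_ <- drop _ _) _; lia.
Qed.

Lemma v_of_conc x :
  (forall y, (0 < size y < size x)%N -> entries homog y ->
     bar_conc (dphi y) (phi y)) ->
  entries homog x -> bar_conc (dphi x + 1) (v_of (@phi k Q R) x).
Proof.
move=> IH hx c cd; rewrite /v_of big_nat_cond big1 // => t /andP[/andP[t0 tx] _].
rewrite big1 // => s _ /=; have hy := entries_hatp (s := s) hx.
have ty : (t < size (hatp s))%N by rewrite size_hatp.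
rewrite (bracket_conc (IH (take t (hatp s)) _ _) (IH (drop t (hatp s)) _ _))
  ?scaler0 //;
  rewrite ?size_takel ?size_drop ?(ltnW ty) ?size_hatp //; try lia.
- exact: entries_take.
- exact: entries_drop.
by move: cd; rewrite -(dphi_hatp s) (dphi_split (hatp s) t); lia.
Qed.

Lemma l_of_conc x : (1 < size x)%N ->
  (forall y, (0 < size y < size x)%N -> entries homog y ->
     bar_conc (dphi y) (phi y)) ->
  entries homog x -> bz_conc (dphi x + 1) (l_of (@phi k Q R) x).
Proof.
move=> x1 IH hx; have -> : l_of (@phi k Q R) x = Fup (v_of (@phi k Q R) x).
  by case: x x1 {IH hx} => [|? []].
by apply: Fup_conc; apply: v_of_conc.
Qed.

(** The arguments [l_of phi (take r y) :: drop r y] in u are not of degree 1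
    even when all the entries of x are, so the induction needs arbitrary
    homogeneous arguments. *)
Lemma phi_conc x : entries homog x -> bar_conc (dphi x) (@phi k Q R x).
Proof.
elim: {x}_.+1 {-2}x (ltnSn (size x)) => // N IH x xN hx.
have [x1|] := leqP (size x) 1.
  case: x x1 {xN} hx => [|z []] //= _ hx.
  rewrite /dphi big_seq1 /= (_ : _ + 2 - _ = z.1 + 1); last lia.
  by apply: Gup_conc; apply: (hx 0%N).
move=> x1; rewrite phiE // (_ : dphi x = dphi x + 1 - 1); last lia.
have {}IH y : (0 < size y < size x)%N -> entries homog y ->
  bar_conc (dphi y) (phi y).
  by move=> /andP[_ yx]; apply: IH; lia.
apply: Hup_conc; apply: concD; last exact: v_of_conc.
move=> c cd; rewrite /u_of big_nat_cond big1 // => r /andP[/andP[r1 rx] _].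
rewrite big1 // => s _ /=; set y := hatp s.
have hy : entries homog y by apply: entries_hatp.
have sy : size y = size x by apply: size_hatp.
have sr : size (take r y) = r by rewrite size_takel // sy; lia.
have dr : dphi (take r y) = \sum_(z <- take r y) z.1 + 2 - r%:Z.
  by rewrite /dphi sr.
rewrite (IH _ _ (entries_cons _ (entries_drop hy))) ?scaler0 //=.
- rewrite size_drop sy; lia.
- rewrite /homog /= -dr; apply: l_of_conc; rewrite ?sr //; last exact: entries_take.
  by move=> z zr; apply: IH; lia.
apply: contraNneq cd => ->; rewrite -(dphi_hatp s) -/y (dphi_split y r) dr.
rewrite /dphi big_cons /= size_drop.
set a := \sum_(_ <- take _ _) _; set b := \sum_(_ <- drop _ _) _; lia.
Qed.

End Cochains.

(** * Vanishing of phi on short arguments, and of l *)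

Section Vanishing.
Variables (k : fieldType) (Q : quiver) (n : nat).
Hypothesis n_gt0 : (0 < n)%N.
Local Notation R := (@Rn Q n).
Local Notation path := (qpath Q).
Local Notation tri := (path * seq path * path)%type.
Local Notation helt := (helt k R).
Local Notation zz := ((0, fun=> 0) : helt).
Local Notation phi := (@phi k Q R).

Lemma inI_Rn (p : path) : inI R p = (n <= plen p)%N.
Proof. by rewrite leqNgt -redE negbK. Qed.

Lemma ext0_val (T : choiceType) (P : pred T) (M : zmodType)
  (f : {x : T | P x} -> M) u : ext0 f (val u) = f u.
Proof. by rewrite /ext0 valK. Qed.

Lemma G_gen_eq0 e v : ~~ G_cond R v -> G_gen k R (e, v) = 0.
Proof. by rewrite /G_gen => ->. Qed.

Lemma ext0_Gup_eq0 f e v : ~~ G_cond R v -> ext0 (@Gup k Q R f) (e, v) = 0.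
Proof.
by move=> Gv; apply: ext0_eq0 => c cv; rewrite /Gup cv G_gen_eq0 // /bzhat lin0.
Qed.

Lemma ext0_Hup_eq0 f e v : H_gen k R (size v) (e, v) = 0 ->
  ext0 (@Hup k Q R f) (e, v) = 0.
Proof.
move=> Hv; apply: ext0_eq0 => c cv.
by rewrite /Hup cv Hv /barhat lin0 scaler0.
Qed.

Lemma phi_arrow_right x e u b : (1 < size x)%N -> plen b = 1%N ->
  ext0 (phi x) (e, [:: u; b]) = 0.
Proof.
by move=> x1 b1; rewrite phiE //; apply: ext0_Hup_eq0; apply: H2_eq0.
Qed.

Lemma phi1_short z e u b : (plen u + plen b < n)%N ->
  ext0 (phi [:: z]) (e, [:: u; b]) = 0.
Proof.
move=> ub; apply: ext0_Gup_eq0; rewrite /= inI_Rn andbT -ltnNge.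
exact: leq_ltn_trans (plen_pcat_le _ _) ub.
Qed.

(** Here u b is not in I.  This takes care of the values of phi which make up u,
    whatever the brackets l_r in their first arguments are. *)
Lemma phi_short3 x e w u b : plen b = 1%N -> (plen u + 1 < n)%N ->
  ext0 (phi x) (e, [:: w; u; b]) = 0.
Proof.
move=> b1 un; have [x1|x1] := ltnP 1 (size x).
  by rewrite phiE //; apply: ext0_Hup_eq0; apply: H3_eq0.
case: x x1 => [|z []] // _; first by apply: ext0_eq0.
apply: ext0_Gup_eq0; rewrite /= inI_Rn andbT -ltnNge.
by apply: leq_ltn_trans (plen_pcat_le _ _) _; rewrite b1.
Qed.

Lemma circ22_eq0 (f g : barcochain k R) e w u b :
  ext0 g (e, [:: w; u]) = 0 \/ (forall e v, ext0 f (e, [:: v; b]) = 0) ->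
  (forall e, ext0 g (e, [:: u; b]) = 0) \/
    (forall e v, ext0 f (e, [:: w; v]) = 0) ->
  circ 2 2 f g (e, [:: w; u; b]) = 0.
Proof.
move=> gf1 gf2; rewrite /circ big_ord_recl big_ord1 /=.
have -> : lin (fun a : {p | red R p} => ext0 f (e, [:: val a; b]))
    (ext0 g (e, [:: w; u])) = 0.
  case: gf1 => [->|f0]; first exact: lin0.
  by apply: (@lin_eq0 _ _ _ _ (fun=> True)).
have -> : lin (fun a : {p | red R p} => ext0 f (e, [:: w; val a]))
    (ext0 g (ptgt w, [:: u; b])) = 0.
  case: gf2 => [->|f0]; first exact: lin0.
  by apply: (@lin_eq0 _ _ _ _ (fun=> True)).
by rewrite !scaler0 addr0.
Qed.

Definition deg1 (z : helt) := z.1 = 1 /\ bz_conc 2 z.2.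

Lemma deg1_homog x : entries deg1 x -> entries (@homog k Q R) x.
Proof. by move=> x1 i /x1 []; rewrite /homog => ->. Qed.

Lemma dphi_deg1 x : entries deg1 x -> dphi x = 2.
Proof.
move=> x1; rewrite /dphi (big_nth zz) big_mkord.
rewrite (eq_bigr (fun=> 1)); first by rewrite sumr_const card_ord; lia.
by move=> i _; case: (x1 _ (ltn_ord i)).
Qed.

Lemma phi_conc2 x : entries deg1 x -> bar_conc 2 (phi x).
Proof. by move=> x1; rewrite -(dphi_deg1 x1); apply/phi_conc/deg1_homog. Qed.

(** The alternative on v is there for a single argument, where phi_1 = G^* is
    known to be zero at (a, v) only when a v is shorter than n. *)
Definition arrow_left x := forall e a v, plen a = 1%N ->
  (1 < size x)%N \/ (plen v + 1 < n)%N -> ext0 (phi x) (e, [:: a; v]) = 0.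

(** If the outer cochain has several arguments it is killed by its last or its
    first entry, which is an arrow; otherwise the inner cochain is killed, by
    the number of its arguments or by the length of u. *)
Lemma circ_phi_eq0 x y e w u b : (0 < size x)%N -> (0 < size y)%N ->
  arrow_left x -> arrow_left y -> plen w = 1%N -> plen b = 1%N ->
  (2 < size x + size y)%N \/ (plen u + 1 < n)%N ->
  circ 2 2 (phi x) (phi y) (e, [:: w; u; b]) = 0.
Proof.
move=> x0 y0 Ax Ay w1 b1 small; apply: circ22_eq0.
  have [x1|x1] := ltnP 1 (size x); first by right=> *; apply: phi_arrow_right.
  by left; apply: Ay => //; case: small => [xy|]; [left; lia|right].
have [y1|y1] := ltnP 1 (size y); first by left=> *; apply: phi_arrow_right.
have [x1|x1] := ltnP 1 (size x); first by right=> *; apply: Ax => //; left.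
left=> e'; case: y y0 y1 Ay small => [|z []] //= _ _ _ [xy|ub]; first lia.
by apply: phi1_short; rewrite b1.
Qed.

Lemma v_of_eq0 x c e w u b : entries deg1 x ->
  (forall y, (0 < size y < size x)%N -> entries deg1 y -> arrow_left y) ->
  val c = (e, [:: w; u; b]) -> plen w = 1%N -> plen b = 1%N ->
  (2 < size x)%N \/ (plen u + 1 < n)%N -> v_of phi x c = 0.
Proof.
move=> x1 A cE w1 b1 small; rewrite /v_of big_nat_cond big1 // => t.
move=> /andP[/andP[t0 tx] _]; rewrite big1 // => s _ /=; set y := hatp s.
have y1 : entries deg1 y by apply: entries_hatp.
have sy : size y = size x by apply: size_hatp.
have st : size (take t y) = t by rewrite size_takel // sy ltnW.
have sd : size (drop t y) = (size x - t)%N by rewrite size_drop sy.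
have yt : entries deg1 (take t y) by apply: entries_take.
have yd : entries deg1 (drop t y) by apply: entries_drop.
have At : arrow_left (take t y) by apply: A => //; lia.
have Ad : arrow_left (drop t y) by apply: A => //; lia.
have {}small : (2 < size (take t y) + size (drop t y))%N \/ (plen u + 1 < n)%N.
  by rewrite st sd; case: small => ?; [left; lia|right].
rewrite (bracket22_eq0 (phi_conc2 yt) (phi_conc2 yd)) ?scaler0 // cE;
  apply: circ_phi_eq0; rewrite ?st ?sd //; lia.
Qed.

Lemma u_of_eq0 x c e w u b : val c = (e, [:: w; u; b]) ->
  plen b = 1%N -> (plen u + 1 < n)%N -> u_of phi x c = 0.
Proof.
move=> cE b1 un; rewrite /u_of big1 // => r _; rewrite big1 // => s _ /=.
by rewrite -[_ c]ext0_val cE phi_short3 ?scaler0.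
Qed.

Lemma map_plen3 (v : seq path) l1 l2 l3 : map (@plen Q) v = [:: l1; l2; l3] ->
  exists w u b, [/\ v = [:: w; u; b], plen w = l1, plen u = l2 & plen b = l3].
Proof.
by case: v => [|w [|u [|b [|? ?]]]] //= [<- <- <-]; exists w, u, b.
Qed.

(** Induction on the number of arguments: H_2 (a, v) only involves triples
    (a, u, b) with |u| < |v| < n, so |u| + 1 < n, and v_s is
    made of values of phi on shorter sequences. *)
Lemma phi_arrow_left x : (0 < size x)%N -> entries deg1 x -> arrow_left x.
Proof.
elim: {x}_.+1 {-2}x (ltnSn (size x)) => // N IH x xN x0 x1 e a v a1 small.
have [x2|x2] := ltnP 1 (size x); last first.
  case: x x0 x2 small {x1 xN} => [|z []] // _ _ [//|vn].
  by apply: phi1_short; rewrite a1 addnC.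
apply: ext0_eq0 => c cE; rewrite phiE // /Hup cE /= sqrrN expr1n scale1r.
have vn : (plen v < n)%N.
  by have := valP c; rewrite cE /chain /= -redE => /andP[_ /and3P[_ /andP[]]].
apply: barhat_eq0 (@H2_lens k Q n n_gt0 e a v) _ => -[[a0 v'] b'].
move=> [l1 [l [l1_1 lv /map_plen3 [w [u [b [/= -> w1 u1 b1]]]]]]].
apply: ext0_eq0 => c' c'E; rewrite (u_of_eq0 _ c'E) ?add0r; [|lia..].
apply: (v_of_eq0 x1 _ c'E); rewrite ?w1 ?u1; [|lia|lia|right; lia].
by move=> y /andP[y0 yx]; apply: IH; lia.
Qed.

Lemma l_eq0 x : (2 < size x)%N -> entries deg1 x ->
  forall w, l_of phi x w = 0.
Proof.
move=> x2 x1 w; have -> : l_of phi x = Fup (v_of phi x).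
  by case: x x2 {x1} => [|? []].
have vc : bar_conc 3 (v_of phi x).
  rewrite (_ : 3 = dphi x + 1); last by rewrite dphi_deg1.
  by apply: v_of_conc (deg1_homog x1) => y _; apply: phi_conc.
have [w3|w3] := eqVneq (val w).1 3; last first.
  by apply: (Fup_conc vc); apply: contraNneq w3 => -[->].
case: w w3 => -[j p] APp /= j3; subst j.
apply: barhat_eq0 (@F3_lens k Q n n_gt0 p APp) _ => -[[a0 v'] b'].
move=> [l _ /map_plen3 [w [u [b [/= -> w1 u1 b1]]]]].
apply: ext0_eq0 => c cE; apply: (v_of_eq0 x1 _ cE) => //; last by left.
by move=> y /andP[y0 _]; apply: phi_arrow_left.
Qed.

End Vanishing.

Theorem proposition4p10 (k : fieldType) (char0 : [pchar k] =i pred0)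
  (Q : quiver) (n : nat) (n_ge2 : (2 <= n)%N)
  (m : nat) (m_ge3 : (3 <= m)%N)
  (f : 'I_m -> bzcochain k (@Rn Q n)) (f_deg : forall i, in_bz 2 (f i)) :
  forall w, l [tuple (1 : int, f i) | i < m] w = 0.
Proof.
apply: l_eq0; rewrite ?size_tuple //; first exact: ltnW.
move=> i; rewrite size_tuple => im.
have -> : i = Ordinal im by [].
rewrite -tnth_nth tnth_mktuple; split=> // w wn2.
by case: (f_deg (Ordinal im)) => _; apply.
Qed.
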